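(* Let $n\geq 12$ with $n\equiv 0\pmod 4$ and $r=5$. Let $V=\{w_1,w_2,w_3,w_4\}\sqcup\{u_1,\dots,u_{n-4}\}$ and consider the labelled graph on $V$ with edges: label $0$ on $\{w_3,u_1\},\{w_4,u_2\}$; label $1$ on $\{u_2,u_3\},\{w_2,w_3\}$; label $2$ on $\{u_1,u_2\},\{u_3,u_4\},\{w_1,w_2\},\{w_3,w_4\}$; and for $4\leq s\leq n-5$, $\{u_s,u_{s+1}\}$ with label $3$ if $s$ is even and label $4$ if $s$ is odd. Then $G\cong A_n$ and $(G,(\rho_0,\dots,\rho_4))$ is a string C-group of rank 5 with Schläfli type $\{3,4,6,n-7\}$.
   Context: A string group generated by involutions (sggi) of rank $r$ is a pair $(G,(\rho_0,\dots,\rho_{r-1}))$ where $\rho_0,\dots,\rho_{r-1}$ are involutions generating the group $G$ such that $(\rho_i\rho_j)^2=1$ whenever $|i-j|\geq 2$. It is a string C-group if in addition it satisfies the intersection property: for all $J,K\subseteq\{0,\dots,r-1\}$, $\langle \rho_j : j\in J\rangle\cap\langle\rho_k : k\in K\rangle=\langle \rho_j : j\in J\cap K\rangle$. The Schläfli type is $\{p_1,\dots,p_{r-1}\}$ where $p_i$ is the order of $\rho_{i-1}\rho_i$. Labelled-graph convention: the vertex set $V$ is finite, and each edge $\{a,b\}$ ($a\neq b$) carries one or more labels from $\{0,\dots,r-1\}$, the edges carrying any given label being pairwise disjoint; $\rho_k$ denotes the permutation of $V$ equal to the product of the transpositions $(a\,b)$ over all edges $\{a,b\}$ carrying label $k$,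 and $G=\langle\rho_0,\dots,\rho_{r-1}\rangle\leq \mathrm{Sym}(V)$. *)

(* Defs.v *)
From HB Require Import structures.
From mathcomp Require Import all_boot all_order all_fingroup all_solvable.
Set Implicit Arguments. Unset Strict Implicit. Unset Printing Implicit Defensive.
Local Open Scope group_scope.

Definition sggi (gT : finGroupType) (r : nat) (G : {set gT}) (rho : 'I_r -> gT) :=
  [/\ G = <<[set rho i | i : 'I_r]>>,
      (forall i, #[rho i] = 2) &
      (forall i j : 'I_r, (i + 2 <= j)%N -> (rho i * rho j) ^+ 2 = 1)].

Definition intersection_property (gT : finGroupType) (r : nat) (rho : 'I_r -> gT) :=
  forall J K : {set 'I_r},
    <<[set rho i | i in J]>> :&: <<[set rho i | i in K]>> = <<[set rho i | i in J :&: K]>>.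

Definition string_C_group (gT : finGroupType) (r : nat) (G : {set gT})
    (rho : 'I_r -> gT) :=
  sggi G rho /\ intersection_property rho.

Definition schlafli_type (gT : finGroupType) (r : nat) (rho : 'I_r -> gT)
    (p : seq nat) :=
  size p = r.-1 /\
  forall i j : 'I_r, val j = (val i).+1 -> #[rho i * rho j] = nth 0 p i.

(* transposition (a b) of 'I_n (identity if a or b is out of range; never
   happens below). *)
Definition tpermn (n a b : nat) : {perm 'I_n} :=
  match insub a, insub b with
  | Some x, Some y => tperm x y
  | _, _ => 1
  end.

Definition edge_perm (n : nat) (E : seq (nat * nat)) : {perm 'I_n} :=
  \prod_(e <- E) tpermn n e.1 e.2.

(* Vertex encoding: w_k (1<=k<=4) is k-1, u_i (1<=i<=n-4) is i+3. *)
Definition w (k : nat) : nat := k.-1.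
Definition u (i : nat) : nat := i + 3.

Definition edges_thm45 (n : nat) (k : nat) : seq (nat * nat) :=
  match k with
  | 0 => [:: (w 3, u 1); (w 4, u 2)]
  | 1 => [:: (u 2, u 3); (w 2, w 3)]
  | 2 => [:: (u 1, u 2); (u 3, u 4); (w 1, w 2); (w 3, w 4)]
  | 3 => [seq (u s, u s.+1) | s <- iota 4 (n - 8) & ~~ odd s]
  | 4 => [seq (u s, u s.+1) | s <- iota 4 (n - 8) & odd s]
  | _ => [::]
  end.

Definition rho_thm45 (n : nat) (k : 'I_5) : {perm 'I_n} :=
  edge_perm n (edges_thm45 n k).

Definition G_thm45 (n : nat) : {group {perm 'I_n}} :=
  <<[set rho_thm45 n i | i : 'I_5]>>%G.

(* Main.v *)
(* By an induction on |J| + |K|, the intersection property of a string group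
   follows from <rho_k : k < j> :&: <rho_k : k > i> = <rho_k : i < k < j> for
   i <= j.  Here these intersections are controlled by invariants on the points
   0..n-1: an element x of <rho_k : k > i> agrees on an initial segment
   [0, bound i) with some d in <rho_k : i < k < 3>, and x d^-1 fixes that segment.
   - For j = 3 the group <rho_0, rho_1, rho_2> is that of a cube on the vertices
     0..7, where fixing the face 0..3 forces x d^-1 = 1; smaller j reduce to this.
   - For j = 4 an element of <rho_0, ..., rho_3> is even, preserves 0..8 and acts
     on the other points like 1 or like rho_3.  Elements acting on 0..8 as the
     transpositions (c 8), bound i <= c, all lie in <rho_k : i < k < 4>; sifting
     with them leaves an even permutation fixing 0..8, which must be 1.
   For G = A_n, the transposition tau = (7 8) normalizes G because G contains the
   3-cycle (rho_2 rho_3)^2; the graph being connected, <G, tau> is the symmetric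
   group, so G has index at most 2 in it, and all generators are even. *)

Require Import Defs.
From HB Require Import structures.
From mathcomp Require Import all_boot all_order all_fingroup all_solvable.
From mathcomp Require Import zify.
Set Implicit Arguments. Unset Strict Implicit. Unset Printing Implicit Defensive.

(** * Reduction of the intersection property to prefixes and suffixes *)

Section GeneratedSubgroups.

Open Scope group_scope.

Variables (gT : finGroupType) (r : nat) (rho : 'I_r -> gT).
Implicit Types (J K : {set 'I_r}) (x : gT).

Definition gam J : {group gT} := <<[set rho i | i in J]>>%G.

Lemma gam_gen J i : i \in J -> rho i \in gam J.
Proof. by move=> iJ; apply/mem_gen/imset_f. Qed.

Lemma gamS J K : J \subset K -> gam J \subset gam K.
Proof. by move=> sJK; apply/genS/imsetS. Qed.

Lemma gam_ind J (P : gT -> Prop) :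
    P 1 -> (forall x i, x \in gam J -> i \in J -> P x -> P (x * rho i)) ->
  forall x, x \in gam J -> P x.
Proof.
move=> P1 PM x /gen_prodgP[m [c cJ ->]].
suff []: (\prod_(i < m) c i \in gam J) /\ P (\prod_(i < m) c i) by [].
elim: m c cJ => [|m IH] c cJ; first by rewrite big_ord0.
have [i|Gc Pc] := IH (fun i => c (widen_ord (leqnSn m) i)); first exact: cJ.
have /imsetP[j jJ cmax] := cJ ord_max.
rewrite big_ord_recr /= cmax; split; last exact: PM.
by rewrite groupM ?gam_gen.
Qed.

Hypothesis comm_rho :
  forall i j : 'I_r, i + 2 <= j -> commute (rho i) (rho j).

(** Indices on opposite sides of [k] differ by at least 2, so the two subgroups centralize each
    other and their join is their product. *)
Lemma gam_split J (k : 'I_r) x : k \notin J -> x \in gam J ->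
  exists y z, [/\ y \in gam [set i in J | i < k],
                  z \in gam [set i in J | k < i] & x = y * z].
Proof.
move=> kJ xJ.
have sub: gam J \subset
    gam [set i in J | i < k] <*> gam [set i in J | k < i].
  rewrite gen_subG; apply/subsetP=> _ /imsetP[i iJ ->].
  case: (ltngtP i k) => [ik|ki|/val_inj ik]; last by rewrite -ik iJ in kJ.
    by apply: (subsetP (joing_subl _ _)); rewrite gam_gen // inE iJ.
  by apply: (subsetP (joing_subr _ _)); rewrite gam_gen // inE iJ.
have := subsetP sub _ xJ; rewrite cent_joinEr; first by case/mulsgP=> y z; exists y, z.
rewrite gen_subG centsC gen_subG; apply/subsetP=> _ /imsetP[i + ->].
rewrite inE => /andP[_ ik]; apply/centP=> _ /imsetP[j + ->].
by rewrite inE => /andP[_ kj]; apply: comm_rho; lia.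
Qed.

(* If a product [y z] over the generators below and above i equals a product
   [y' z'] over those below and above j, then [y'^-1 y = z' z^-1] lies in both
   a prefix and a suffix subgroup. *)
Lemma gam_meet_step J K (i j : 'I_r) :
    gam [set k : 'I_r | k < j] :&: gam [set k : 'I_r | i < k]
      \subset gam [set k : 'I_r | i < k < j] ->
    i \notin J -> j \notin K -> [set k : 'I_r | i < k < j] \subset J :&: K ->
    gam [set k in J | k < i] :&: gam K \subset gam (J :&: K) ->
    gam J :&: gam [set k in K | j < k] \subset gam (J :&: K) ->
    i <= j ->
  gam J :&: gam K \subset gam (J :&: K).
Proof.
move=> Hij iJ jK /gamS sub IHl IHr le_ij.
apply/subsetP=> x /setIP[xJ xK].
have [y [z [yJ zJ xyz]]] := gam_split iJ xJ.
have [y' [z' [yK zK xyz']]] := gam_split jK xK.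
have [sJ sK] : gam (J :&: K) \subset gam J /\ gam (J :&: K) \subset gam K.
  by rewrite !gamS ?subsetIl ?subsetIr.
have mE : z' * z^-1 = y'^-1 * y.
  by apply: (mulgI y'); rewrite !mulgA -xyz' xyz mulgK mulgV mul1g.
have m_in : y'^-1 * y \in gam (J :&: K).
  apply/(subsetP sub)/(subsetP Hij)/setIP; split; last rewrite -mE.
    rewrite groupM ?groupV //; [apply: subsetP yK|apply: subsetP yJ];
      apply: gamS; apply/subsetP=> k; rewrite !inE => /andP[] // _ ki.
    exact: leq_trans ki _.
  rewrite groupM ?groupV //; [apply: subsetP zK|apply: subsetP zJ];
    apply: gamS; apply/subsetP=> k; rewrite !inE => /andP[] // _.
  exact: leq_ltn_trans.
(* Since [y] is [y'] times the common element, it lies in [gam K] too, and the hypothesis on the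
   truncated [J] applies; [z'] is treated symmetrically. *)
have yJK : y \in gam (J :&: K).
  apply/(subsetP IHl)/setIP; split=> //.
  rewrite -(mulKVg y' y) groupM ?(subsetP sK _ m_in) //.
  by apply: subsetP yK; apply: gamS; apply/subsetP=> k; rewrite inE => /andP[].
have zJK : z' \in gam (J :&: K).
  apply/(subsetP IHr)/setIP; split=> //.
  rewrite -(mulgKV z z') mE groupM ?(subsetP sJ _ m_in) //.
  by apply: subsetP zJ; apply: gamS; apply/subsetP=> k; rewrite inE => /andP[].
have -> : x = y * (y'^-1 * y)^-1 * z' by rewrite invMg invgK mulKVg.
by rewrite !groupM ?groupV.
Qed.

Lemma intersection_of_prefix_suffix :
    (forall i j : 'I_r, i <= j ->
       gam [set k : 'I_r | k < j] :&: gam [set k : 'I_r | i < k]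
         \subset gam [set k : 'I_r | i < k < j]) ->
  intersection_property rho.
Proof.
move=> Hij; suff meet J K : gam J :&: gam K \subset gam (J :&: K).
  move=> J K; apply/eqP; rewrite eqEsubset meet subsetI.
  by rewrite (gamS (subsetIl J K)) (gamS (subsetIr J K)).
have [m] := ubnP (#|J| + #|K|); elim: m J K => // m IH J K ltJKm.
have [sKJ|/subsetPn[i0 iK iJ]] := boolP (K \subset J).
  by rewrite (setIidPr sKJ) subsetIr.
have [sJK|/subsetPn[j0 jJ jK]] := boolP (J \subset K).
  by rewrite (setIidPl sJK) subsetIl.
pose P (p : 'I_r * 'I_r) := (p.1 \in K :\: J) && (p.2 \in J :\: K).
have P0 : P (i0, j0) by rewrite /P !inE iK iJ jJ jK.
(* With truncated subtraction, this sum is the distance between the two indices. *)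
case: (arg_minnP (fun p : 'I_r * 'I_r => (p.1 - p.2) + (p.2 - p.1)) P0) => -[i j] {i0 j0 iK iJ jJ jK P0}.
rewrite /P /= !inE => /andP[/andP[iJ iK] /andP[jK jJ]] minij.
have {P minij} between (k : 'I_r) : (i < k < j) || (j < k < i) ->
    (k \in J) = (k \in K).
  move=> kij; apply/idP/idP => Hk; apply: contraTT kij => Hk'.
    by have := minij (i, k); rewrite /= !inE iJ iK Hk Hk' => /(_ isT); lia.
  by have := minij (k, j); rewrite /= !inE jJ jK Hk Hk' => /(_ isT); lia.
wlog lt_ij : i j J K ltJKm iJ iK jJ jK between / i < j.
  move=> wl; case: (ltngtP i j) => [||/val_inj eq_ij]; first exact: wl.
    move=> ji; rewrite setIC (setIC J); apply: (wl j i) => //.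
      by rewrite addnC.
    by move=> k; rewrite orbC => /between.
  by rewrite -eq_ij iK in jK.
have shrink (L : {set 'I_r}) (k : 'I_r) (Q : pred 'I_r) : k \in L -> ~~ Q k ->
    #|[set l in L | Q l]| < #|L|.
  move=> kL nQk; apply: proper_card; apply/properP; split.
    by apply/subsetP=> l'; rewrite inE => /andP[].
  by exists k; rewrite // inE kL.
(* The last two inequalities make the induction decrease: cutting [J] at [i'] drops [j], and cutting
   [K] at [j'] drops [i]. *)
suff [i' [j' [le_ij' [iJ' jK'] sub [ij' i'j]]]] : exists i' j' : 'I_r,
    [/\ i' <= j', i' \notin J /\ j' \notin K,
        [set k : 'I_r | i' < k < j'] \subset J :&: K & i <= j' /\ i' <= j].
  apply: (gam_meet_step (Hij _ _ le_ij') iJ' jK' sub) => //.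
    apply: subset_trans (IH _ _ _) (gamS _); last first.
      by apply: setSI; apply/subsetP=> k; rewrite inE => /andP[].
    have := shrink J j (fun k : 'I_r => k < i') jJ; lia.
  apply: subset_trans (IH _ _ _) (gamS _); last first.
    by apply: setIS; apply/subsetP=> k; rewrite inE => /andP[].
  have := shrink K i (fun k : 'I_r => j' < k) iK; lia.
(* An index strictly between and absent from both sets serves as both cuts. Otherwise all indices
   between lie in both sets, and the cuts are [i] and [j]. *)
have [/existsP[k /and4P[ik kj kJ kK]]|nk] :=
    boolP [exists k : 'I_r, [&& i < k, k < j, k \notin J & k \notin K]].
  exists k, k; split=> //; last by split; lia.
  by apply/subsetP=> l; rewrite inE; lia.
exists i, j; split=> //; try by split; lia.
  lia.
apply/subsetP=> k; rewrite !inE => kij; move/existsPn/(_ k): nk.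
by have := between k; rewrite kij => /(_ isT) ->; case/andP: kij => -> ->; case: (k \in K).
Qed.

End GeneratedSubgroups.

(** * Permutations of ['I_n] computed on natural numbers *)

Section PermutationsOfNat.

Open Scope group_scope.

Variable n : nat.
Implicit Types s t : {perm 'I_n}.

(* Extending a permutation of ['I_n] by the identity on [nat] lets the points
   be written as numerals, without proofs of [k < n]. *)
Definition app s (k : nat) : nat :=
  if insub k is Some x then val (s x) else k.

Lemma app_val s (x : 'I_n) : app s x = s x.
Proof. by rewrite /app valK. Qed.

Lemma app_big s k : n <= k -> app s k = k.
Proof. by move=> nk; rewrite /app insubN // -leqNgt. Qed.

Lemma app_lt s k : (app s k < n) = (k < n).
Proof. by rewrite /app; case: insubP => [x -> _|/negbTE->]; rewrite ?ltn_ord. Qed.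

Lemma app1 k : app 1 k = k.
Proof. by rewrite /app; case: insubP => //= x _; rewrite perm1. Qed.

Lemma appM s t k : app (s * t) k = app t (app s k).
Proof.
have [kn|nk] := ltnP k n; last by rewrite !app_big.
by rewrite -[k]/(val (Ordinal kn)) !app_val permM.
Qed.

Lemma app_inj s : injective (app s).
Proof. by move=> j k /(congr1 (app s^-1)); rewrite -!appM mulgV !app1. Qed.

Lemma app_eq s t : (forall k, app s k = app t k) -> s = t.
Proof. by move=> st; apply/permP=> x; apply/val_inj; rewrite /= -!app_val. Qed.

Definition swapn a b k : nat := if k == a then b else if k == b then a else k.

Lemma swapn_gt a b k : a < k -> b < k -> swapn a b k = k.
Proof. by move=> ak bk; rewrite /swapn !ifF //; lia. Qed.

Lemma app_tpermn a b k : a < n -> b < n -> app (tpermn n a b) k = swapn a b k.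
Proof.
move=> an bn; rewrite /tpermn !insubT /= /swapn.
have [kn|nk] := ltnP k n; last by rewrite app_big //; do ?case: ifP => ?; lia.
rewrite -[k in LHS]/(val (Ordinal kn)) app_val permE /= -!val_eqE /=.
by case: ifP => // _; case: ifP.
Qed.

Lemma tpermnJ a b s : a < n -> b < n ->
  tpermn n a b ^ s = tpermn n (app s a) (app s b).
Proof.
move=> an bn; have [san sbn] : app s a < n /\ app s b < n by rewrite !app_lt.
rewrite /tpermn !insubT /= tpermJ; congr tperm; apply/val_inj => /=.
  by rewrite -app_val.
by rewrite -app_val.
Qed.

Lemma odd_tpermn a b : a < n -> b < n -> odd_perm (tpermn n a b) = (a != b).
Proof. by move=> an bn; rewrite /tpermn !insubT /= odd_tperm -val_eqE. Qed.

Definition in_range (E : seq (nat * nat)) :=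
  all (fun e => (e.1 < n) && (e.2 < n)) E.

Lemma app_edge_perm E k : in_range E ->
  app (edge_perm n E) k = foldl (fun y e => swapn e.1 e.2 y) k E.
Proof.
rewrite /edge_perm; elim: E k => [|[a b] E IH] k; first by rewrite big_nil app1.
by case/andP=> /andP[an bn] /IH{}IH; rewrite big_cons appM IH app_tpermn.
Qed.

Lemma odd_edge_perm E : in_range E -> all (fun e => e.1 != e.2) E ->
  odd_perm (edge_perm n E) = odd (size E).
Proof.
rewrite /edge_perm; elim: E => [|[a b] E IH] /=; first by rewrite big_nil odd_perm1.
case/andP=> /andP[an bn] /IH{}IH /andP[ab /IH{}IH].
by rewrite big_cons odd_permM IH odd_tpermn // ab.
Qed.

Lemma foldl_swapn_path c h k :
  foldl (fun y e => swapn e.1 e.2 y) k [seq (c + i.*2, (c + i.*2).+1) | i <- iota 0 h]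
  = if c <= k < c + h.*2 then (if odd (k - c) then k.-1 else k.+1) else k.
Proof.
elim: h => [|h IH]; first by rewrite /=; case: ifP => ?; lia.
rewrite -addn1 iotaD map_cat foldl_cat IH /= add0n addn1 doubleS /swapn /=.
have [?|?] := boolP (c <= k < c + h.*2); first case: (boolP (odd (k - c))) => ?.
all: by do ?case: ifP => ?; lia.
Qed.

End PermutationsOfNat.

(** * The five generators as explicit commuting or non-commuting involutions *)

Section Generators.

Open Scope group_scope.

Variable n : nat.
Hypotheses (n12 : 12 <= n) (n4 : n %% 4 = 0).

Notation rho := (rho_thm45 n).
Notation "''r_' k" := (rho (@Ordinal 5 k isT)) (at level 8, k at level 2, format "''r_' k").

(* The other end of the edge labelled [k] at [x], or [x] itself if there is none. *)
Definition nbr (k x : nat) : nat := match k with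
  | 0 => nth x [:: 0; 1; 4; 5; 2; 3]%N x
  | 1 => nth x [:: 0; 2; 1; 3; 4; 6; 5]%N x
  | 2 => nth x [:: 1; 0; 3; 2; 5; 4; 7; 6]%N x
  | 3 => if 7 <= x < n.-1 then (if odd x then x.+1 else x.-1) else x
  | _ => if 8 <= x < n then (if odd x then x.-1 else x.+1) else x
  end.

Lemma filter_iota_parity (e : bool) c h :
  [seq s <- iota c h.*2 | odd s == odd c (+) e] = [seq c + e + i.*2 | i <- iota 0 h].
Proof.
elim: h => // h IH; rewrite doubleS -addn2 -(addn1 h) !iotaD filter_cat IH.
rewrite map_cat /= oddD odd_double addbF add0n.
by clear IH; case: e; case: (odd c); congr cat; congr cons; lia.
Qed.

(** The boolean treats labels 3 ([false]) and 4 ([true]) together. As [n - 8] is even, each label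
    gets half of the path edges, starting at 7 or 8. *)
Lemma edges34E (e : bool) : edges_thm45 n (3 + e) =
  [seq (7 + e + i.*2, (7 + e + i.*2).+1) | i <- iota 0 (n - 8)./2].
Proof.
have nE : n - 8 = ((n - 8)./2).*2 by lia.
transitivity [seq (u s, u s.+1) | s <- [seq s <- iota 4 (n - 8) | odd s == odd 4 (+) e]].
  by case: e; congr map; apply: eq_filter => s /=; case: (odd s).
rewrite {1}nE filter_iota_parity -map_comp; apply: eq_map => i /=.
by rewrite /u; congr pair; lia.
Qed.

Lemma in_range_edges k : in_range n (edges_thm45 n k).
Proof.
have range34 (e : bool) : in_range n (edges_thm45 n (3 + e)).
  by rewrite edges34E; apply/allP=> _ /mapP[i + ->]; rewrite mem_iota /=; lia.
case: k => [|[|[|[|[|k]]]]] //; [..|exact: (range34 false)|exact: (range34 true)].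
all: by rewrite /in_range /= /u; lia.
Qed.

Lemma app_rho (k : 'I_5) x : app (rho k) x = nbr k x.
Proof.
have app34 (e : bool) : app (edge_perm n (edges_thm45 n (3 + e))) x = nbr (3 + e) x.
  rewrite app_edge_perm ?in_range_edges // edges34E foldl_swapn_path.
  have -> : 7 + e + ((n - 8)./2).*2 = n.-1 + e by lia.
  by case: e => /=; case: ifP => // ?; do 3 (try case: ifP => ?); lia.
case: k => -[|[|[|[|[|//]]]]] ?; [..|exact: (app34 false)|exact: (app34 true)].
all: clear app34; rewrite app_edge_perm ?in_range_edges //; do 9 (case: x => [|x] //).
Qed.

(** Labels 0, 1, 2 have 2 or 4 edges; labels 3 and 4 have [(n - 8)./2] each, which is even because 4
    divides [n]. *)
Lemma odd_rho (k : 'I_5) : odd_perm (rho k) = false.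
Proof.
have odd34 (e : bool) : odd_perm (edge_perm n (edges_thm45 n (3 + e))) = false.
  rewrite odd_edge_perm ?in_range_edges // edges34E ?size_map ?size_iota; first lia.
  by apply/allP=> _ /mapP[i _ ->] /=; lia.
case: k => -[|[|[|[|[|//]]]]] ?; [..|exact: (odd34 false)|exact: (odd34 true)].
all: by rewrite odd_edge_perm ?in_range_edges.
Qed.

Lemma nbr_default k x : k <= 2 -> 6 + k <= x -> nbr k x = x.
Proof. by case: k => [|[|[|//]]] _ ?; rewrite /= nth_default. Qed.

Lemma nbr_lt k x : k <= 2 -> x < 6 + k -> nbr k x < 6 + k.
Proof. by case: k => [|[|[|//]]] _; do 8 (case: x => [|x] //). Qed.

Lemma nbr_fix3 x : x < 7 -> nbr 3 x = x.
Proof. by rewrite /=; case: ifP; lia. Qed.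

Lemma nbr_fix4 x : x < 8 -> nbr 4 x = x.
Proof. by rewrite /=; case: ifP; lia. Qed.

Lemma nbrK k : involutive (nbr k).
Proof.
move=> x; case: k => [|[|[|[|k]]]].
1-3: by have [|x8] := ltnP x 8; [do 8 (case: x => [|x] //)|rewrite !nbr_default //; lia].
all: rewrite [in X in nbr _ X]/nbr; do ?case: ifP => ?;
  by rewrite /nbr; do ?case: ifP => ?; lia.
Qed.

(** For labels 0 and 2 this is a check on eight points. In the other cases the supports are
    disjoint, separated by [6 + i]. *)
Lemma nbr_comm i j x : i + 2 <= j < 5 -> nbr i (nbr j x) = nbr j (nbr i x).
Proof.
case: j => [|[|[|j]]] ij; try lia.
  have -> : i = 0 by lia.
  have [|x8] := ltnP x 8; first by do 8 (case: x => [|x] //).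
  by rewrite !nbr_default //; lia.
have [fix_lt fix_ge] : (x < 6 + i -> nbr j.+3 x = x) /\ (6 + i <= x -> 6 + i <= nbr j.+3 x).
  by case: j ij => [|[|j]] ij /=; do ?case: ifP => ?; lia.
have [x_lt|x_ge] := ltnP x (6 + i).
  rewrite fix_lt //; have := @nbr_lt i x ltac:(lia) x_lt.
  by case: j ij {fix_lt fix_ge} => [|[|j]] ij /=; do ?case: ifP => ?; lia.
by rewrite (@nbr_default i x) ?(nbr_default _ (fix_ge _)) //; lia.
Qed.

Lemma rho_sq k : rho k * rho k = 1.
Proof. by apply: app_eq => x; rewrite appM !app_rho app1 nbrK. Qed.

Lemma rho_comm (i j : 'I_5) : i + 2 <= j -> commute (rho i) (rho j).
Proof.
move=> ij; apply: app_eq => x.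
by rewrite !appM !app_rho (@nbr_comm i j) ?ij ?ltn_ord.
Qed.

Lemma rho_neq1 k : rho k != 1.
Proof.
pose x := nth 0 [:: 2; 1; 0; 7; 8]%N k.
suff: nbr k x != x by apply: contraNneq => r1; rewrite -app_rho r1 app1.
by rewrite {}/x; case: k => -[|[|[|[|[|//]]]]] _ //=; case: ifP; lia.
Qed.

Lemma order_rho k : #[rho k] = 2.
Proof.
by apply: nt_prime_order; rewrite ?rho_neq1 // expgS expg1 rho_sq.
Qed.

Lemma rho_sggi : sggi (G_thm45 n) rho.
Proof.
split=> // [|i j ij]; first exact: order_rho.
by rewrite (expgMn _ (rho_comm ij)) !(expgS, expg0, mulg1) !rho_sq mulg1.
Qed.

(** * Invariants of the prefix and suffix subgroups *)

Notation below j := (gam rho [set k : 'I_5 | k < j]).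
Notation above i := (gam rho [set k : 'I_5 | i < k]).
Notation between i j := (gam rho [set k : 'I_5 | i < k < j]).

Lemma between_below i j l : j <= l -> between i j \subset below l.
Proof. by move=> jl; apply: gamS; apply/subsetP=> k; rewrite !inE; lia. Qed.

Lemma below_below j l : j <= l -> below j \subset below l.
Proof. by move=> jl; apply: gamS; apply/subsetP=> k; rewrite !inE; lia. Qed.

(* The elements generated by [rho_(i+1), ..., rho_4] preserve [0, bound i), and
   [rho_k] with [k > i], [k >= 3] fixes it pointwise. *)
Definition bound (i : nat) : nat := nth 9 [:: 4; 6; 7; 8]%N i.

Lemma bound_ge4 i : 4 <= bound i.
Proof. by case: i => [|[|[|[|i]]]]; rewrite /bound //= nth_nil. Qed.

Lemma nbr_bound i (k : 'I_5) x : i < k -> x < bound i ->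
  nbr k x < bound i /\ (3 <= k -> nbr k x = x).
Proof.
move=> ik xb; have [k3|k3] := ltnP k 3.
  split; last lia.
  by case: k ik k3 => -[|[|[|//]]] ? /=; case: i xb => [|[|i]] //=;
    move=> xb _ _; move: x xb; do 6 (case=> //).
suff E : nbr k x = x by rewrite E.
case: k k3 ik => -[|[|[|[|[|//]]]]] //= ? _ ik; [apply: nbr_fix3|apply: nbr_fix4].
all: by case: i ik xb => [|[|[|[|i]]]] //= _; rewrite /bound /=; lia.
Qed.

(** Deleting [rho_3] and [rho_4] from a word for [x] gives [d], since both fix the segment that the
    word preserves. *)
Lemma above_local i x : x \in above i -> exists2 d, d \in between i 3 &
  forall y, y < bound i -> app x y = app d y /\ app x y < bound i.
Proof.
move: x; apply: gam_ind => [|x k _]; first by exists 1 => // y; rewrite app1.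
rewrite inE => ik [d dG xd]; have [k3|k3] := ltnP k 3.
  exists (d * rho k) => [|y yb]; first by rewrite groupM // gam_gen // inE ik.
  have [xdy xb] := xd y yb; rewrite !appM -xdy; split=> //.
  by rewrite app_rho; have [] := nbr_bound ik xb.
exists d => // y yb; have [<- xb] := xd y yb.
by rewrite appM app_rho; have [? ->] := nbr_bound ik xb.
Qed.

Lemma nbr_lt9 k x : k <= 3 -> x < 9 -> nbr k x < 9.
Proof. by case: k => [|[|[|[|//]]]] _; do 9 (case: x => [|x] //=; try by case: ifP). Qed.

Lemma nbr3_ge9 x : 9 <= x -> 9 <= nbr 3 x.
Proof. by move=> x9; rewrite /=; do ?case: ifP => ?; lia. Qed.

(** From 9 on only [rho_3] acts, so the parity of its occurrences in a word decides between the two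
    alternatives. *)
Lemma below4_inv x : x \in below 4 ->
  [/\ forall y, y < 9 -> app x y < 9,
      (forall y, 9 <= y -> app x y = y) \/ (forall y, 9 <= y -> app x y = nbr 3 y)
    & odd_perm x = false].
Proof.
move: x; apply: gam_ind => [|x k _].
  by split; [move=> y; rewrite app1|left=> y; rewrite app1|exact: odd_perm1].
rewrite inE => k4 [x9 xtail x0]; split; last by rewrite odd_permM x0 odd_rho.
  by move=> y /x9 y9; rewrite appM app_rho nbr_lt9.
have [k3|k3] := ltnP k 3.
  have kfix y : 9 <= y -> nbr k y = y by move=> ?; apply: nbr_default; lia.
  case: xtail => xtail; [left|right] => y y9; rewrite appM app_rho xtail // kfix //.
  exact: nbr3_ge9.
have -> : rho k = 'r_3 by congr rho; apply/val_inj => /=; lia.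
case: xtail => xtail; [right|left] => y y9; rewrite appM app_rho xtail //.
exact: (nbrK 3).
Qed.

Lemma below3_antipodal x : x \in below 3 ->
  (forall y, y < 8 -> app x (7 - y) = 7 - app x y /\ app x y < 8)
  /\ (forall y, 8 <= y -> app x y = y).
Proof.
move: x; apply: gam_ind => [|x k _]; first by split=> y; rewrite !app1.
rewrite inE => k3 [xin xout]; split=> y y8; rewrite !appM !app_rho; last first.
  by rewrite xout // nbr_default //; lia.
have [-> +] := xin y y8; move: (app x y); case: k k3 => -[|[|[|//]]] //= _ _.
all: by do 8 (case=> //).
Qed.

(* <rho_0, rho_1, rho_2> acts on 0..7 as the symmetry group of a cube on its
   vertices, with antipodal map [y |-> 7 - y] and with 0..3 as a face. *)
Lemma below3_eq1 x : x \in below 3 -> (forall y, y < 4 -> app x y = y) -> x = 1.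
Proof.
move=> /below3_antipodal[xin xout] x4; apply: app_eq => y; rewrite app1.
have [y4|y4] := ltnP y 4; first exact: x4.
have [y8|y8] := ltnP y 8; last exact: xout.
have [|+ _] := xin (7 - y); first lia.
by rewrite (x4 (7 - y)) ?subKn //; lia.
Qed.

(** * Sifting in the prefix of rank 4 *)

Lemma swapnJ k a b y : nbr k (swapn a b (nbr k y)) = swapn (nbr k a) (nbr k b) y.
Proof.
have E z : (nbr k y == z) = (y == nbr k z).
  by apply/eqP/eqP => [<-|->]; rewrite nbrK.
by rewrite /swapn !E; do 2 case: ifP => // _; rewrite nbrK.
Qed.

(* [rho_3] and its conjugates under [rho_1], [rho_2] act on 0..8 as the
   transpositions (c 8), and all of them act on the other points as [rho_3]. *)
Lemma star i c : bound i <= c < 8 -> exists2 h, h \in between i 4 &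
  forall y, y < 9 -> app h y = swapn c 8 y.
Proof.
have conj (k : 'I_5) a h : i < k < 3 -> h \in between i 4 ->
    (forall y, y < 9 -> app h y = swapn a 8 y) ->
  exists2 h', h' \in between i 4 &
    forall y, y < 9 -> app h' y = swapn (nbr k a) 8 y.
  move=> ik hG hE; have kG : rho k \in between i 4 by rewrite gam_gen // inE; lia.
  exists (rho k * h * rho k) => [|y y9]; first by rewrite !groupM.
  rewrite !appM !app_rho hE ?nbr_lt9 ?swapnJ; try lia.
  by rewrite (@nbr_default k 8) //; lia.
(* Labels 2, 1, 2 lead from 7 to 6, 5 and 4, starting with [rho_3] for 7. The generators above [i]
   carry this chain down exactly to [bound i]. *)
have star7 : i < 3 -> exists2 h, h \in between i 4 &
    forall y, y < 9 -> app h y = swapn 7 8 y.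
  move=> i3; exists 'r_3 => [|y y9]; first by rewrite gam_gen // inE i3.
  by rewrite app_rho /= /swapn; do ?case: ifP => ?; lia.
have star6 : i < 2 -> exists2 h, h \in between i 4 &
    forall y, y < 9 -> app h y = swapn 6 8 y.
  move=> i2; have [|h hG hE] := star7; first lia.
  by apply: (conj (@Ordinal 5 2 isT) 7 h) => //=; rewrite i2.
have star5 : i < 1 -> exists2 h, h \in between i 4 &
    forall y, y < 9 -> app h y = swapn 5 8 y.
  move=> i1; have [|h hG hE] := star6; first lia.
  by apply: (conj (@Ordinal 5 1 isT) 6 h) => //=; rewrite i1.
have star4 : i < 1 -> exists2 h, h \in between i 4 &
    forall y, y < 9 -> app h y = swapn 4 8 y.
  move=> i1; have [|h hG hE] := star5; first lia.
  by apply: (conj (@Ordinal 5 2 isT) 5 h) => //=; lia.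
have [i3|i3] := ltnP i 3; last first.
  by case: i i3 {conj star7 star6 star5 star4} => [|[|[|[|[|i]]]]]; rewrite /bound /=; lia.
rewrite /bound; case: i i3 star7 star6 star5 star4 {conj} => [|[|[|//]]] /= _ s7 s6 s5 s4.
all: case: c => [|[|[|[|[|[|[|[|]]]]]]]] //= _.
all: by [exact: s7|exact: s6|exact: s5|exact: s4].
Qed.

(** Points are fixed one at a time, those below [bound i] being fixed already. If [c] goes to [d],
    then [d >= c] because smaller values are taken, and [(d 8)] followed by [(c 8)] brings [d] to
    [c] through 8. For [d = 8] the second factor suffices. *)
Lemma sift i x c : x \in below 4 -> (forall y, y < bound i -> app x y = y) ->
  c <= 8 -> exists2 h, h \in between i 4 & forall y, y < c -> app (x * h) y = y.
Proof.
move=> xG xfix; elim: c => [|c IH] c8; first by exists 1; rewrite ?group1.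
have [|h hG hfix] := IH; first lia.
have [cb|bc] := ltnP c (bound i).
  by exists 1 => // y yc; rewrite mulg1 xfix //; lia.
have x'G : x * h \in below 4.
  by rewrite groupM // (subsetP (between_below i (leqnn 4))).
move: (x * h) x'G hfix {IH xG xfix} (fun h' => mulgA x h h') => x' x'G hfix assoc.
suff [h' h'G h'fix] : exists2 h', h' \in between i 4 &
    forall y, y < c.+1 -> app (x' * h') y = y.
  by exists (h * h') => [|y]; [rewrite groupM|rewrite assoc; apply: h'fix].
have [x'9 _ _] := below4_inv x'G.
have d9 : app x' c < 9 by apply: x'9; lia.
have cd : c <= app x' c.
  rewrite leqNgt; apply/negP=> dc; have := app_inj (hfix _ dc); lia.
have [hc hcG hcE] : exists2 h, h \in between i 4 &
    forall y, y < 9 -> app h y = swapn c 8 y by apply: star; rewrite bc.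
have [d8|d8] := ltnP (app x' c) 8; last first.
  exists hc => // y; rewrite ltnS leq_eqVlt appM => /predU1P[->|yc].
    by rewrite hcE // /swapn; do ?case: ifP => ?; lia.
  by rewrite hfix // hcE /swapn; [do ?case: ifP => ?|]; lia.
have [hd hdG hdE] : exists2 h, h \in between i 4 &
    forall y, y < 9 -> app h y = swapn (app x' c) 8 y by apply: star; rewrite d8; lia.
exists (hd * hc) => [|y]; first by rewrite groupM.
rewrite ltnS leq_eqVlt !appM => /predU1P[->|yc].
  have -> : app hd (app x' c) = 8 by rewrite hdE // /swapn eqxx.
  by rewrite hcE // /swapn eqxx; case: ifP => ?; lia.
rewrite hfix // hdE; last lia.
have -> : swapn (app x' c) 8 y = y by rewrite /swapn; do ?case: ifP => ?; lia.
by rewrite hcE /swapn; [do ?case: ifP => ?|]; lia.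
Qed.

Lemma below4_fixing i x : x \in below 4 ->
  (forall y, y < bound i -> app x y = y) -> x \in between i 4.
Proof.
move=> xG xfix; have [h hG hfix] := sift xG xfix (leqnn 8).
have hG4 : h \in below 4 by apply: (subsetP (between_below i (leqnn 4))).
suff xh1 : x * h = 1 by rewrite -(mulgK h x) xh1 mul1g groupV.
have [x9 xtail xeven] := below4_inv (groupM xG hG4).
have x8 : app (x * h) 8 = 8.
  have := x9 8 isT; rewrite ltnS leq_eqVlt => /predU1P[//|lt8].
  by have := app_inj (hfix _ lt8); lia.
have xlt9 y : y < 9 -> app (x * h) y = y.
  by rewrite ltnS leq_eqVlt => /predU1P[->|/hfix].
case: xtail => xtail.
  by apply: app_eq => y; rewrite app1; case: (ltnP y 9) => [/xlt9|/xtail].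
(* As [rho_3] swaps 7 and 8, this product fixes 0..8 and acts as [rho_3] beyond; it is odd, which
   excludes it. *)
suff xE : x * h = 'r_3 * tpermn n 7 8.
  by move: xeven; rewrite xE odd_permM odd_rho odd_tpermn //; lia.
apply: app_eq => y; rewrite appM app_rho app_tpermn; try lia.
have [y9|y9] := ltnP y 9; [rewrite xlt9 //|rewrite xtail //]; rewrite /swapn.
  have [y7|y7] := ltnP y 7; first by rewrite nbr_fix3 //; do ?case: ifP => ?; lia.
  have /orP[] : (y == 7) || (y == 8) by lia.
    by move/eqP->; have -> : nbr 3 7 = 8 by rewrite /=; case: ifP; lia.
  by move/eqP->; have -> : nbr 3 8 = 7 by rewrite /=; case: ifP; lia.
by have := nbr3_ge9 y9; move: (nbr 3 y) => z z9; do ?case: ifP => ?; lia.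
Qed.

(** * Intersections of prefixes with suffixes *)

Lemma below3_above_meet i x : x \in below 3 -> x \in above i -> x \in between i 3.
Proof.
move=> x3 xi; have [d dG dE] := above_local xi.
suff /(congr1 (mulg^~ d)) : x * d^-1 = 1 by rewrite mulgKV mul1g => ->.
have dG3 : d \in below 3 by apply: (subsetP (between_below i (leqnn 3))).
apply: below3_eq1 => [|y y4]; first by rewrite groupM ?groupV.
have [|E _] := dE y; first exact: leq_trans y4 (bound_ge4 i).
by rewrite appM E -appM mulgV app1.
Qed.

Lemma between_stab2 i x : 1 <= i -> x \in between i 3 ->
  forall y, y < 2 -> app x y < 2.
Proof.
move=> i1; move: x; apply: gam_ind => [y|x k _]; first by rewrite app1.
rewrite inE => ik IH y /IH; rewrite appM app_rho; move: (app x y).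
have -> : k = 2 :> nat by lia.
by do 2 (case=> //).
Qed.

(** Like [rho_0] and [rho_1], [x] fixes 0. It also lies in [<rho_1, rho_2>], which respects the
    opposite corners [y] and [3 - y] of the square 0..3. So it fixes or swaps 1 and 2, and is 1 or
    [rho_1]; a swap forces [i = 0], as [rho_2] preserves {0, 1}. *)
Lemma below2_above_meet i x : x \in below 2 -> x \in above i -> x \in between i 2.
Proof.
move=> x2 xi; have x3 := subsetP (below_below (leqnSn 2)) _ x2.
have x03 := below3_above_meet x3 xi.
have x0 : app x 0 = 0.
  move: x x2 {xi x3 x03}; apply: gam_ind => [|x k _]; first by rewrite app1.
  rewrite inE => k2 x0; rewrite appM x0 app_rho.
  by case: k k2 => -[|[|]].
have square : forall y, y < 4 -> app x (3 - y) = 3 - app x y /\ app x y < 4.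
  have : x \in between 0 3.
    by apply: (subsetP (gamS _ _)) x03; apply/subsetP=> k; rewrite !inE; lia.
  move: (x); apply: gam_ind => [|z k _]; first by move=> y; rewrite !app1.
  rewrite inE => k12 zE y y4; rewrite !appM !app_rho.
  have [-> +] := zE y y4; move: (app z y); case: k k12 => -[|[|[|//]]] //= _ _;
    by do 4 (case=> //).
have x3E : app x 3 = 3 by have [] := square 0 isT; rewrite x0.
have x2E : app x 2 = 3 - app x 1 by have [] := square 1%N isT.
have x1_lt : app x 1 < 4 by have [] := square 1%N isT.
have [x1E|x1E] := eqVneq (app x 1) 1%N.
  suff E : x = 1 by rewrite E group1.
  by apply: below3_eq1 => // -[|[|[|[|y]]]] // _; rewrite x2E x1E.
have i0 : i = 0.
  have [//|i1] := posnP i.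
  by have := between_stab2 i1 x03 (leqnn 2); have := @app_inj _ x 0%N 1%N; lia.
have x1E2 : app x 1 = 2.
  by have := @app_inj _ x 0%N 1%N; have := @app_inj _ x 3%N 1%N; lia.
suff : x * 'r_1 = 1.
  move/(congr1 (mulg^~ 'r_1)); rewrite -mulgA rho_sq mulg1 mul1g => ->.
  by rewrite gam_gen // inE i0.
apply: below3_eq1 => [|[|[|[|[|y]]]] // _]; first by rewrite groupM // gam_gen // inE.
all: rewrite appM app_rho.
- by rewrite x0.
- by rewrite x1E2.
- by rewrite x2E x1E2.
by rewrite x3E.
Qed.

(** As a power of [rho_0], [x] fixes 0 and 1. The previous case puts it in [<rho_1>] too, so it
    fixes 3 and sends 2 below 3. By injectivity it fixes the whole face 0..3. *)
Lemma below1_above_meet i x : x \in below 1 -> x \in above i -> x = 1.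
Proof.
move=> x1 xi; have x2 := subsetP (below_below (leqnSn 1)) _ x1.
have x02 := below2_above_meet x2 xi.
apply: below3_eq1 => [|y y4]; first exact: (subsetP (below_below (leqnSn 2))).
have fix1 : forall y, y < 2 -> app x y = y.
  move: x x1 {xi x2 x02}; apply: gam_ind => [|x k _]; first by move=> z; rewrite app1.
  rewrite inE => k1 xE z z2; rewrite appM xE // app_rho.
  by case: k k1 => -[|//] ? _; move: z z2; do 2 (case=> //).
have fix2 : (y == 0) || (y == 3) -> app x y = y.
  move: x x02 {x1 xi x2 fix1}; apply: gam_ind => [|x k _]; first by rewrite app1.
  rewrite inE => k2 xE yE; rewrite appM xE // app_rho.
  have -> : k = 1%N :> nat by lia.
  by move/orP: yE => [] /eqP->.
have stab3 : app x 2 < 3.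
  move: x x02 {x1 xi x2 fix1 fix2}; apply: gam_ind => [|x k _]; first by rewrite app1.
  rewrite inE appM app_rho => k2; have -> : k = 1%N :> nat by lia.
  by move: (app x 2); do 3 (case=> //).
have [y2|y2] := ltnP y 2; first exact: fix1.
have [/eqP y3|y3] := boolP (y == 3); first by apply: fix2; rewrite y3.
have -> : y = 2 by lia.
have := @app_inj _ x 0%N 2%N; have := @app_inj _ x 1%N 2%N.
by rewrite (fix1 0) // (fix1 1%N) //; lia.
Qed.

Lemma below_above_meet (i j : 'I_5) : i <= j ->
  below j :&: above i \subset between i j.
Proof.
move=> ij; apply/subsetP=> x /setIP[xj xi].
case: j ij xj => -[|[|[|[|[|//]]]]] ? /= ij xj.
- suff E : x = 1 by rewrite E group1.
  by apply: (below1_above_meet _ xi); apply: (subsetP (below_below (leqnSn 0))).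
- by rewrite (below1_above_meet xj xi) group1.
- exact: below2_above_meet.
- exact: below3_above_meet.
have [d dG dE] := above_local xi.
have dG4 : d \in between i 4.
  by apply: (subsetP (gamS _ _)) dG; apply/subsetP=> k; rewrite !inE; lia.
rewrite -(mulgKV d x) groupM //; apply: below4_fixing => [|y yb].
  by rewrite groupM // groupV (subsetP (between_below i (leqnn 4))).
by rewrite appM (dE y yb).1 -appM mulgV app1.
Qed.

Lemma rho_intersection : intersection_property rho.
Proof.
apply: intersection_of_prefix_suffix; last exact: below_above_meet.
exact: rho_comm.
Qed.

(** * Orders of consecutive products and the Schläfli type *)

Lemma app_exp (x : {perm 'I_n}) k y : app (x ^+ k) y = iter k (app x) y.
Proof. by elim: k y => [|k IH] y; rewrite ?app1 // expgSr appM IH. Qed.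

Lemma order_eq (x : {perm 'I_n}) m : 0 < m ->
    (forall y, iter m (app x) y = y) ->
    (forall k, 0 < k < m -> exists y, iter k (app x) y != y) ->
  #[x] = m.
Proof.
move=> m0 xm xk; have dvd_m : #[x] %| m.
  by rewrite order_dvdn; apply/eqP/app_eq => y; rewrite app_exp xm app1.
apply/eqP; rewrite eqn_leq dvdn_leq //= leqNgt; apply/negP=> lt_m.
have [|y] := xk #[x]; first by rewrite order_gt0.
by rewrite -app_exp expg_order app1 eqxx.
Qed.

Lemma order_rho01 : #['r_0 * 'r_1] = 3.
Proof.
apply: order_eq => // [y|k k3].
  rewrite /= !appM !app_rho; have [|y8] := ltnP y 8; first by move: y; do 8 (case=> //).
  have fixy k : k <= 2 -> nbr k y = y by move=> ?; apply: nbr_default; lia.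
  by rewrite !fixy.
by exists 3; case: k k3 => [|[|[|]]] //= _; rewrite !appM !app_rho.
Qed.

Lemma order_rho12 : #['r_1 * 'r_2] = 4.
Proof.
apply: order_eq => // [y|k k4].
  rewrite /= !appM !app_rho; have [|y8] := ltnP y 8; first by move: y; do 8 (case=> //).
  have fixy k : k <= 2 -> nbr k y = y by move=> ?; apply: nbr_default; lia.
  by rewrite !fixy.
by exists 4; case: k k4 => [|[|[|[|]]]] //= _; rewrite !appM !app_rho.
Qed.

Lemma app_rho23 y : app ('r_2 * 'r_3) y =
  if y < 9 then nth 0 [:: 1; 0; 3; 2; 5; 4; 8; 6; 7]%N y else nbr 3 y.
Proof.
rewrite appM !app_rho; have [y9|y9] := ltnP y 9; last first.
  by rewrite [nbr 2 y]nbr_default //; lia.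
by case: y y9 => [|[|[|[|[|[|[|[|[|y]]]]]]]]] //= _; case: ifP => //; lia.
Qed.

Lemma app_rho23_sq y : 9 <= y -> app ('r_2 * 'r_3) (app ('r_2 * 'r_3) y) = y.
Proof.
move=> y9; rewrite (app_rho23 y) ltnNge y9 app_rho23 ltnNge /=.
by rewrite (nbr3_ge9 y9); apply: (nbrK 3).
Qed.

Lemma order_rho23 : #['r_2 * 'r_3] = 6.
Proof.
apply: order_eq => // [y|k k6].
  have [y9|y9] := ltnP y 9.
    by case: y y9 => [|[|[|[|[|[|[|[|[|y]]]]]]]]] //= _; rewrite !app_rho23.
  by rewrite /= !app_rho23_sq.
(* The point 6 lies on a 3-cycle; only the third power fixes it, and that power moves 0, which lies
   on a 2-cycle. *)
case: k k6 => [|[|[|[|[|[|]]]]]] //= _; [exists 6|exists 6|exists 0|exists 6|exists 6].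
all: by rewrite !app_rho23.
Qed.

(* The cycle of [rho_3 rho_4] through 7: up the odd points, down the even ones. *)
Definition path_cycle k := if 7 + k.*2 < n then 7 + k.*2 else (n - 4 - k).*2.

(** The points 7..n-1 form a single cycle and all others are fixed. *)
Lemma order_rho34 : #['r_3 * 'r_4] = n - 7.
Proof.
have step k : k < n - 7 ->
    app ('r_3 * 'r_4) (path_cycle k) = if k.+1 < n - 7 then path_cycle k.+1 else 7.
  move=> kn; rewrite appM !app_rho /path_cycle.
  have [c1|c1] := ltnP (7 + k.*2) n; first have [c2|c2] := ltnP (7 + k.*2) n.-1.
  - have -> : nbr 3 (7 + k.*2) = 8 + k.*2 by rewrite /nbr; do ?case: ifP => ?; lia.
    have -> : nbr 4 (8 + k.*2) = 9 + k.*2 by rewrite /nbr; do ?case: ifP => ?; lia.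
    by do ?case: ifP => ?; lia.
  - have -> : nbr 3 (7 + k.*2) = 7 + k.*2 by rewrite /nbr; do ?case: ifP => ?; lia.
    have -> : nbr 4 (7 + k.*2) = 6 + k.*2 by rewrite /nbr; do ?case: ifP => ?; lia.
    by do ?case: ifP => ?; lia.
  have -> : nbr 3 (n - 4 - k).*2 = (n - 4 - k).*2.-1.
    by rewrite /nbr; do ?case: ifP => ?; lia.
  have -> : nbr 4 (n - 4 - k).*2.-1 = if k.+1 < n - 7 then (n - 5 - k).*2 else 7.
    by rewrite /nbr; do ?case: ifP => ?; lia.
  by do ?case: ifP => ?; lia.
have iter7 k : k < n - 7 -> iter k (app ('r_3 * 'r_4)) 7 = path_cycle k.
  elim: k => [|k IH] kn; first by rewrite /path_cycle /=; case: ifP; lia.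
  by rewrite iterS IH ?step ?kn //; lia.
have iter_n7 : iter (n - 7) (app ('r_3 * 'r_4)) 7 = 7.
  have nE : n - 7 = (n - 8).+1 by lia.
  by rewrite nE iterS iter7 ?step; try case: ifP; lia.
apply: order_eq => [|y|k kn]; first lia.
  have [y7|y7] := ltnP y 7.
    apply: iter_fix; rewrite appM !app_rho nbr_fix3 // nbr_fix4 //; lia.
  have [ny|yn] := leqP n y; first by apply: iter_fix; rewrite app_big.
  have [k kn ->] : exists2 k, k < n - 7 & y = iter k (app ('r_3 * 'r_4)) 7.
    have [y_odd|y_even] := boolP (odd y); [exists (y - 7)./2|exists (n - 4 - y./2)]; try lia.
      by rewrite iter7 /path_cycle; [case: ifP => ?|]; lia.
    by rewrite iter7 /path_cycle; [case: ifP => ?|]; lia.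
  by rewrite -iterD addnC iterD iter_n7.
by exists 7; rewrite iter7 /path_cycle; do ?case: ifP => ?; lia.
Qed.

Lemma rho_schlafli : schlafli_type rho [:: 3; 4; 6; n - 7]%N.
Proof.
split=> // i j; case: i => -[|[|[|[|[|//]]]]] i5; case: j => -[|[|[|[|[|//]]]]] j5 // _.
all: rewrite (bool_irrelevance i5 isT) (bool_irrelevance j5 isT).
- exact: order_rho01.
- exact: order_rho12.
- exact: order_rho23.
exact: order_rho34.
Qed.

(** * Identification of the group with the alternating group *)

Lemma tpermnC a b : tpermn n a b = tpermn n b a.
Proof. by rewrite /tpermn; case: insubP; case: insubP => // *; rewrite tpermC. Qed.

Lemma tpermn_sq a b : tpermn n a b * tpermn n a b = 1.
Proof. by rewrite /tpermn; do 2 (case: insubP => *; rewrite ?mulg1 ?tperm2 //). Qed.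

Lemma rho_in_G k : rho k \in G_thm45 n.
Proof. exact/mem_gen/imset_f. Qed.

Notation tau := (tpermn n 7 8).

Lemma tau_rho (k : 'I_5) : tau ^ rho k = tpermn n (nbr k 7) (nbr k 8).
Proof. by rewrite tpermnJ ?app_rho //; lia. Qed.

(* The commutators of [tau] with the generators are trivial or 3-cycles, the
   3-cycle on 6, 7, 8 being the square of [rho_2 rho_3]. *)
Lemma tau_norm : tau \in 'N(G_thm45 n).
Proof.
have lt_n k : k < 12 -> k < n by move=> ?; apply: leq_trans n12.
have t678 : tpermn n 6 8 * tau = ('r_2 * 'r_3) ^+ 2.
  apply: app_eq => y; rewrite app_exp appM !app_tpermn ?lt_n //=.
  have [y9|y9] := ltnP y 9.
    by case: y y9 => [|[|[|[|[|[|[|[|[|y]]]]]]]]] //= _; rewrite !app_rho23.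
  by rewrite app_rho23_sq // !swapn_gt //; lia.
have t678G : tpermn n 6 8 * tau \in G_thm45 n by rewrite t678 groupX // groupM ?rho_in_G.
(* Conjugation by [rho_4] turns 8 into 9 in the 3-cycle; in the quotient of the two cycles the point
   6 cancels. *)
have t6879 : tpermn n 7 9 * tau = (tpermn n 6 8 * tau) ^ 'r_4 * (tpermn n 6 8 * tau)^-1.
  apply: app_eq => y.
  rewrite conjMg !tpermnJ ?lt_n // !app_rho invMg.
  have inv a b : (tpermn n a b)^-1 = tpermn n a b.
    by apply/eqP; rewrite eq_invg_mul tpermn_sq.
  have -> : nbr 4 8 = 9 by rewrite /=; case: ifP; lia.
  have -> : nbr 4 7 = 7 by rewrite nbr_fix4.
  have -> : nbr 4 6 = 6 by rewrite nbr_fix4.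
  rewrite !inv !appM !app_tpermn ?lt_n //.
  have [|y10] := ltnP y 10; first by move: y; do 10 (case=> //).
  by rewrite !swapn_gt //; lia.
have commG k : tau ^ rho k * tau \in G_thm45 n.
  rewrite tau_rho; case: k => -[|[|[|[|[|//]]]]] ?.
  - by rewrite tpermn_sq.
  - by rewrite tpermn_sq.
  - exact: t678G.
  - have -> : nbr 3 7 = 8 by rewrite /=; case: ifP; lia.
    have -> : nbr 3 8 = 7 by rewrite /=; case: ifP; lia.
    by rewrite tpermnC tpermn_sq group1.
  have -> : nbr 4 8 = 9 by rewrite /=; case: ifP; lia.
  have -> : nbr 4 7 = 7 by rewrite nbr_fix4.
  by rewrite t6879 groupM ?groupV ?groupJ ?rho_in_G.
apply/normP/eqP; rewrite eqEcard cardJg leqnn andbT -genJ gen_subG.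
apply/subsetP=> _ /imsetP[_ /imsetP[k _ ->] ->].
have tauV : tau^-1 = tau by apply/eqP; rewrite eq_invg_mul tpermn_sq.
have -> : rho k ^ tau = rho k * (tau ^ rho k * tau).
  by rewrite !conjgE tauV !mulgA mulgV mul1g.
by rewrite groupM ?rho_in_G.
Qed.

(** The transpositions [(8 y)] generate the symmetric group; each is reached from [tau] by
    conjugation along edges of the graph. *)
Lemma join_tau : G_thm45 n <*> <[tau]> = [set: {perm 'I_n}].
Proof.
set K := (G_thm45 n <*> <[tau]>)%G; rewrite -/(gval K).
have tauK : tau \in K by rewrite (subsetP (joing_subr _ _)) ?cycle_id.
have rhoK k : rho k \in K by rewrite (subsetP (joing_subl _ _)) ?rho_in_G.
have lt_n k : k < 12 -> k < n by move=> ?; apply: leq_trans n12.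
have step (k : 'I_5) a b : a < n -> b < n -> tpermn n a b \in K ->
    tpermn n (nbr k a) (nbr k b) \in K.
  by move=> an bn abK; rewrite -!app_rho -tpermnJ // groupJ.
have trans a b c : a < n -> b < n -> c < n -> a != b -> a != c ->
    tpermn n a b \in K -> tpermn n b c \in K -> tpermn n a c \in K.
  move=> an bn cn ab ac abK bcK.
  have -> : tpermn n a c = tpermn n a b ^ tpermn n b c.
    rewrite tpermnJ // !app_tpermn // /swapn eqxx.
    by congr tpermn; do ?case: ifP => ?; lia.
  by rewrite groupJ.
(* Along the path, [rho_4] fixes 7 and moves only the far end. [rho_3] also turns 7 into 8, which
   [trans] with [tau] corrects. *)
have from7 k : 8 + k < n -> tpermn n 7 (8 + k) \in K.
  elim: k => [//|k IH] kn; have {}IH := IH (ltnW kn); rewrite addnS in kn *.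
  have [k_odd|k_even] := boolP (odd k).
    have := step (@Ordinal 5 3 isT) _ _ (lt_n 7 isT) (ltnW kn) IH.
    have -> : nbr 3 7 = 8 by rewrite /=; case: ifP; lia.
    have -> : nbr 3 (8 + k) = (8 + k).+1 by rewrite /nbr; do ?case: ifP => ?; lia.
    by apply: trans tauK; lia.
  have := step (@Ordinal 5 4 isT) _ _ (lt_n 7 isT) (ltnW kn) IH.
  have -> : nbr 4 7 = 7 by rewrite nbr_fix4.
  by have -> : nbr 4 (8 + k) = (8 + k).+1 by rewrite /nbr; do ?case: ifP => ?; lia.
have from8 (k : 'I_5) y : k < 3 -> y < 8 -> tpermn n 8 y \in K -> tpermn n 8 (nbr k y) \in K.
  move=> k3 y8 /step-/(_ k); rewrite (@nbr_default k 8) => [->||]; rewrite ?lt_n //; lia.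
(* The walk 7, 6, 5, 4, 2, 1, 0 and the edge from 5 to 3 use labels that fix 8. *)
have t7 : tpermn n 8 7 \in K by rewrite tpermnC.
have t6 := from8 (@Ordinal 5 2 isT) 7 isT isT t7.
have t5 := from8 (@Ordinal 5 1 isT) 6 isT isT t6.
have t4 := from8 (@Ordinal 5 2 isT) 5 isT isT t5.
have t2 := from8 (@Ordinal 5 0 isT) 4 isT isT t4.
have t1 := from8 (@Ordinal 5 1 isT) 2 isT isT t2.
have t0 := from8 (@Ordinal 5 2 isT) 1%N isT isT t1.
have t3 := from8 (@Ordinal 5 0 isT) 5 isT isT t5.
apply/eqP; rewrite eqEsubset subsetT -(gen_tperm (Ordinal (lt_n 8 isT))) gen_subG.
apply/subsetP=> _ /imsetP[[y yn] _ ->].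
have -> : tperm (Ordinal (lt_n 8 isT)) (Ordinal yn) = tpermn n 8 y.
  by rewrite /tpermn !insubT ?lt_n // => ?; congr tperm; apply/val_inj.
have [|y8] := ltnP y 8; first by case: y {yn} => [|[|[|[|[|[|[|[|y]]]]]]]].
have [->|y8'] := eqVneq y 8; first by rewrite /tpermn; case: insubP => // *; rewrite tperm1 group1.
apply: (trans 8 7 y); rewrite ?(eq_sym 8) ?(lt_n 7) ?(lt_n 8) //.
by have := from7 (y - 8); rewrite subnKC //; apply.
Qed.

Lemma G_eq_Alt : G_thm45 n = 'Alt_('I_n)%G.
Proof.
apply/group_inj/eqP; rewrite eqEcard; apply/andP; split.
  by rewrite gen_subG; apply/subsetP=> _ /imsetP[k _ ->]; rewrite Alt_even odd_rho.
have Alt2 : (2 * #|'Alt_('I_n)| = n`!)%N by rewrite card_Alt card_ord //; lia.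
have Sym : #|G_thm45 n <*> <[tau]>| = n`!.
  by rewrite join_tau -[setT]/('Sym_('I_n) : {set _}) card_Sym card_ord.
have tau2 : #[tau] <= 2.
  by apply: dvdn_leq => //; rewrite order_dvdn expgS expg1 tpermn_sq.
rewrite norm_joinEr ?cycle_subG ?tau_norm // in Sym.
(* The product formula gives [2 * #|G| >= n!], which is twice the order of the alternating group. *)
have := mul_cardG (G_thm45 n) <[tau]>; rewrite Sym -Alt2 => E.
rewrite -(leq_pmul2l (isT : 0 < 2)); apply: leq_trans (leq_mul tau2 (leqnn _)).
by rewrite [leqRHS]mulnC /order E leq_pmulr // cardG_gt0.
Qed.

End Generators.

Theorem theorem4p5 (n : nat) :
  (12 <= n)%N -> n %% 4 = 0 ->
  [/\ G_thm45 n \isog ('Alt_('I_n))%G,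
      string_C_group (G_thm45 n) (rho_thm45 n) &
      schlafli_type (rho_thm45 n) [:: 3; 4; 6; n - 7]].
Proof.
move=> n12 n4; split; last exact: rho_schlafli.
  by rewrite G_eq_Alt // isog_refl.
by split; [exact: rho_sggi|exact: rho_intersection].
Qed.
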